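(* Let $\mathcal{A}=(a_{ijk})$ be a 3rd order 3-dimensional real symmetric tensor with all entries $a_{ijk}\in\{-1,0,1\}$. Suppose that there are $r,s,t\in\{1,2,3\}$ with $r\neq s$, $s\neq t$, $r\neq t$ such that $$a_{rss}=a_{rtt}=a_{123}=1.$$ Then $\mathcal{A}$ is strictly copositive if and only if $a_{iii}=1$ and $a_{iij}+a_{ijj}\ge 0$ for all $i,j\in\{1,2,3\}$ with $i\neq j$.
   Context: A 3rd order 3-dimensional real symmetric tensor is an array $\mathcal{A}=(a_{ijk})_{1\le i,j,k\le 3}$ of real numbers whose entries are invariant under every permutation of the indices. For $x=(x_1,x_2,x_3)^\top\in\mathbb{R}^3$ put $\mathcal{A}x^3=\sum_{i,j,k=1}^3 a_{ijk}x_ix_jx_k$. $\mathcal{A}$ is strictly copositive if $\mathcal{A}x^3>0$ for every $x\neq 0$ with $x_1,x_2,x_3\ge 0$. *)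

(* Defs.v *)
From mathcomp Require Import all_boot all_order all_algebra reals.

Set Implicit Arguments.
Unset Strict Implicit.
Unset Printing Implicit Defensive.

Import Order.TTheory GRing.Theory Num.Theory.
Local Open Scope ring_scope.

(* The indices 1, 2, 3 of the usual notation are the elements 0, 1, 2 of 'I_3. *)
Definition tensor3 (R : Type) := 'I_3 -> 'I_3 -> 'I_3 -> R.

Definition symmetric_tensor (R : Type) (A : tensor3 R) : Prop :=
  forall i j k i' j' k' : 'I_3,
    perm_eq [:: i; j; k] [:: i'; j'; k'] -> A i j k = A i' j' k'.

Definition cubic_form (R : realType) (A : tensor3 R) (x : 'cV[R]_3) : R :=
  \sum_(i < 3) \sum_(j < 3) \sum_(k < 3) A i j k * x i 0 * x j 0 * x k 0.

Definition strictly_copositive (R : realType) (A : tensor3 R) : Prop :=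
  forall x : 'cV[R]_3,
    x != 0 -> (forall i : 'I_3, 0 <= x i 0) -> 0 < cubic_form A x.

(* Main.v *)
(** With [u = x_r], [v = x_s], [w = x_t] and [z = v + w], the hypotheses bound
    the cubic form below by
      [u (u^2 - 3 u z + 3 z^2) + (v^3 + 3 p v^2 w + 3 q v w^2 + w^3)],
    where [p = a_sst], [q = a_stt] and equality holds when [a_rrs = a_rrt = -1].
    The quadratic factor is positive definite, and the binary cubic is positive
    because it is at least [v^3 + w^3], [v^3 + w (3 v^2 - 3 v w + w^2)] or its
    mirror image.  Conversely, evaluating at [e_i] and at [e_i + e_j] gives
    [a_iii > 0] and [2 + 3 (a_iij + a_ijj) > 0], and the entries are
    integers. *)
Require Import Defs.
From mathcomp Require Import all_boot all_order all_algebra reals.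
From mathcomp Require Import ring lra.

Set Implicit Arguments.
Unset Strict Implicit.
Unset Printing Implicit Defensive.

Import Order.TTheory GRing.Theory Num.Theory.
Local Open Scope ring_scope.

Lemma perm_index_enum3 (r s t : 'I_3) :
  uniq [:: r; s; t] -> perm_eq (index_enum 'I_3) [:: r; s; t].
Proof.
move=> Urst; rewrite perm_sym.
apply: uniq_perm => //; first exact: index_enum_uniq.
apply: (uniq_min_size Urst _ _).2.
  by move=> i _; rewrite mem_index_enum.
by rewrite [index_enum _]unlock -enumT size_enum_ord.
Qed.

Lemma ord3_third (i j : 'I_3) : i != j -> exists k, uniq [:: i; j; k].
Proof.
by case: i j => [[|[|[|//]]] ?] [[|[|[|//]]] ?] //= _;
  solve [by exists 0 | by exists 1 | by exists 2].
Qed.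

(** The factors 3 and 6 count the orderings of each index multiset. Keeping [r], [s], [t] arbitrary
    avoids relabelling the indices later. *)
Lemma cubic_formE (R : realType) (A : tensor3 R) (x : 'cV[R]_3) (r s t : 'I_3) :
  symmetric_tensor A -> uniq [:: r; s; t] ->
  cubic_form A x =
    A r r r * x r 0 ^+ 3 + A s s s * x s 0 ^+ 3 + A t t t * x t 0 ^+ 3
    + 3 * (A r r s * x r 0 ^+ 2 * x s 0 + A r s s * x r 0 * x s 0 ^+ 2
         + A r r t * x r 0 ^+ 2 * x t 0 + A r t t * x r 0 * x t 0 ^+ 2
         + A s s t * x s 0 ^+ 2 * x t 0 + A s t t * x s 0 * x t 0 ^+ 2)
    + 6 * A r s t * x r 0 * x s 0 * x t 0.
Proof.
move=> symA Urst.
have sum3 (F : 'I_3 -> R) : \sum_i F i = F r + F s + F t.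
  by rewrite (perm_big _ (perm_index_enum3 Urst)) !big_cons big_nil /= addr0 addrA.
have swap12 i j k : A j i k = A i j k.
  by apply: symA; apply/permP => p /=; rewrite addnCA.
have swap23 i j k : A i k j = A i j k.
  by apply: symA; apply/permP => p /=; rewrite [(p k + _)%N]addnCA.
rewrite /cubic_form !sum3.
(* Adjacent transpositions bring every entry to one representative of its orbit, so that [ring] can
   collect equal monomials. *)
rewrite (swap23 r r s) (swap12 r s r) (swap23 r r s).
rewrite (swap23 r r t) (swap12 r t r) (swap23 r r t).
rewrite (swap12 r s s) (swap23 s r s) (swap12 r s s).
rewrite (swap12 r t t) (swap23 t r t) (swap12 r t t).
rewrite (swap23 s s t) (swap12 s t s) (swap23 s s t).
rewrite (swap12 s t t) (swap23 t s t) (swap12 s t t).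
rewrite (swap23 r s t) (swap12 r s t) (swap23 s r t) (swap12 r s t).
rewrite (swap12 r t s) (swap23 r s t) (swap23 t r s) (swap12 r t s).
rewrite (swap23 r s t).
ring.
Qed.

Lemma binary_cubic_gt0 (R : realFieldType) (p q v w : R) :
  p \in [:: -1; 0; 1] -> q \in [:: -1; 0; 1] -> 0 <= p + q ->
  0 <= v -> 0 <= w -> 0 < v + w ->
  0 < v ^+ 3 + 3 * p * v ^+ 2 * w + 3 * q * v * w ^+ 2 + w ^+ 3.
Proof.
(* The critical case [p = 1], [q = -1]; exchanging [v] and [w] gives the case [p = -1], [q = 1]. *)
have mixed (a b : R) : 0 <= a -> 0 <= b -> 0 < a + b ->
    0 < a ^+ 3 + 3 * a ^+ 2 * b - 3 * a * b ^+ 2 + b ^+ 3.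
  move=> a0 b0 ab.
  have -> : a ^+ 3 + 3 * a ^+ 2 * b - 3 * a * b ^+ 2 + b ^+ 3
      = a ^+ 3 + b * (3 * (a - b / 2) ^+ 2 + b ^+ 2 / 4) by field.
  have a3 : 0 <= a ^+ 3 by exact: exprn_ge0.
  have sq : 0 <= (a - b / 2) ^+ 2 by exact: sqr_ge0.
  have [b_gt0 | b_le0] := ltP 0 b.
    have b2 : 0 < b ^+ 2 by exact: exprn_gt0.
    by apply: ltr_wpDl => //; apply: mulr_gt0 => //; lra.
  have -> : b = 0 by lra.
  by rewrite mul0r addr0 exprn_gt0 //; lra.
move=> p_in q_in pq v0 w0 vw.
have v3 : 0 <= v ^+ 3 by exact: exprn_ge0.
have w3 : 0 <= w ^+ 3 by exact: exprn_ge0.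
have v2w : 0 <= v ^+ 2 * w by rewrite mulr_ge0 ?exprn_ge0.
have vw2 : 0 <= v * w ^+ 2 by rewrite mulr_ge0 ?exprn_ge0.
have vw3 : 0 < v ^+ 3 + w ^+ 3.
  have [v_gt0 | v_le0] := ltP 0 v.
    by apply: ltr_wpDr => //; exact: exprn_gt0.
  by apply: ltr_wpDl => //; apply: exprn_gt0; lra.
have := mixed v w v0 w0 vw.
have : 0 < w ^+ 3 + 3 * w ^+ 2 * v - 3 * w * v ^+ 2 + v ^+ 3.
  by apply: mixed => //; lra.
move: p_in q_in pq; rewrite !inE.
(* Three of the nine cases contradict [0 <= p + q]; the two of mixed sign follow from [mixed], and
   those with [p] and [q] nonnegative from [vw3]. *)
by case/or3P=> /eqP-> /or3P[] /eqP->; lra.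
Qed.

Lemma ternary_cubic_gt0 (R : realFieldType) (a b p q u v w : R) :
  -1 <= a -> -1 <= b ->
  p \in [:: -1; 0; 1] -> q \in [:: -1; 0; 1] -> 0 <= p + q ->
  0 <= u -> 0 <= v -> 0 <= w -> 0 < u + v + w ->
  0 < u ^+ 3 + v ^+ 3 + w ^+ 3
    + 3 * (a * u ^+ 2 * v + u * v ^+ 2 + b * u ^+ 2 * w + u * w ^+ 2
         + p * v ^+ 2 * w + q * v * w ^+ 2)
    + 6 * u * v * w.
Proof.
move=> a1 b1 p_in q_in pq u0 v0 w0 uvw.
(* [uv] and [uw] measure the gain over the worst case [a = b = -1]. *)
have uv : 0 <= (a + 1) * (u ^+ 2 * v) by rewrite !mulr_ge0 ?exprn_ge0 //; lra.
have uw : 0 <= (b + 1) * (u ^+ 2 * w) by rewrite !mulr_ge0 ?exprn_ge0 //; lra.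
set z := v + w; have z0 : 0 <= z by exact: addr_ge0.
set f := v ^+ 3 + 3 * p * v ^+ 2 * w + 3 * q * v * w ^+ 2 + w ^+ 3.
set g := u ^+ 2 - 3 * u * z + 3 * z ^+ 2.
(* The unit coefficients make the terms linear in [u] a square:
   [3 u v^2 + 3 u w^2 + 6 u v w = 3 u z^2]. *)
suff : 0 < u * g + f by rewrite /g /f /z; lra.
have gE : g = 3 * (z - u / 2) ^+ 2 + u ^+ 2 / 4 by rewrite /g; field.
have sq : 0 <= (z - u / 2) ^+ 2 by exact: sqr_ge0.
have f_gt0 : 0 < z -> 0 < f by exact: binary_cubic_gt0.
(* If [u > 0], then [u * g] is positive and [f] need only be nonnegative; if [u = 0], then [z > 0]
   and [f] alone is positive. *)
have [u_gt0 | u_le0] := ltP 0 u.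
  have f_ge0 : 0 <= f.
    have [/f_gt0/ltW // | z_le0] := ltP 0 z.
    have [v_eq0 w_eq0] : v = 0 /\ w = 0 by rewrite /z in z_le0; split; lra.
    by rewrite /f v_eq0 w_eq0; lra.
  have u2 : 0 < u ^+ 2 by exact: exprn_gt0.
  by apply: ltr_wpDr => //; apply: mulr_gt0 => //; rewrite gE; lra.
have -> : u = 0 by lra.
by rewrite mul0r add0r f_gt0 // /z; lra.
Qed.

Lemma cv3_gt0_sum (R : realType) (x : 'cV[R]_3) (r s t : 'I_3) :
  uniq [:: r; s; t] -> x != 0 -> (forall i, 0 <= x i 0) ->
  0 < x r 0 + x s 0 + x t 0.
Proof.
move=> Urst x_neq0 x_ge0.
have -> : x r 0 + x s 0 + x t 0 = \sum_i x i 0.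
  by rewrite (perm_big _ (perm_index_enum3 Urst)) !big_cons big_nil /= addr0 addrA.
rewrite lt0r sumr_ge0 ?andbT // psumr_eq0 //.
apply: contra x_neq0 => /allP x_eq0; apply/eqP/matrixP => i j.
by rewrite ord1 mxE; apply/eqP/x_eq0; rewrite mem_index_enum.
Qed.

(** Evaluation at [e_i + c e_j]: [c = 0] isolates the diagonal entry, and [c = 1] tests the pair. *)
Lemma strictly_copositive_pair (R : realType) (A : tensor3 R) (i j : 'I_3) (c : R) :
  symmetric_tensor A -> strictly_copositive A -> i != j -> 0 <= c ->
  0 < A i i i + A j j j * c ^+ 3 + 3 * (A i i j * c + A i j j * c ^+ 2).
Proof.
move=> symA copA neq_ij c0; have [k Uijk] := ord3_third neq_ij.
pose x : 'cV[R]_3 := \col_l (if l == i then 1 else if l == j then c else 0).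
have xi : x i 0 = 1 by rewrite mxE eqxx.
have xj : x j 0 = c by rewrite mxE eq_sym (negbTE neq_ij) eqxx.
have xk : x k 0 = 0.
  move: Uijk; rewrite /= !inE negb_or => /and3P[/andP[_ ik] jk _].
  by rewrite mxE eq_sym (negbTE ik) eq_sym (negbTE jk).
have x_neq0 : x != 0.
  by apply/eqP => /matrixP/(_ i 0); rewrite xi mxE => /eqP; rewrite oner_eq0.
have x_ge0 l : 0 <= x l 0 by rewrite mxE; do 2 case: ifP => // _.
have := copA x x_neq0 x_ge0.
by rewrite (cubic_formE x symA Uijk) xi xj xk; lra.
Qed.

Theorem theorem3p3 (R : realType) (A : tensor3 R)
    (A_sym : symmetric_tensor A)
    (A_entries : forall i j k : 'I_3, A i j k \in [:: -1; 0; 1])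
    (A_rst : exists r s t : 'I_3,
       [/\ r != s, s != t & r != t] /\
       [/\ A r s s = 1, A r t t = 1 & A 0 1 2 = 1]) :
  strictly_copositive A <->
  (forall i : 'I_3, A i i i = 1) /\
  (forall i j : 'I_3, i != j -> 0 <= A i i j + A i j j).
Proof.
split=> [copA | [A_diag A_pair]].
  have A_diag i : A i i i = 1.
    (* Addition in ['I_3] is cyclic, so [i + 1] serves as a second index; its weight will be
       [c = 0]. *)
    have neq_i : i != i + 1 by case: i => [[|[|[|//]]] ?].
    have := strictly_copositive_pair A_sym copA neq_i (lexx 0).
    have := A_entries i i i; rewrite !inE.
    by case/or3P => /eqP->; rewrite ?expr0n /=; lra.
  split=> // i j neq_ij.
  have := strictly_copositive_pair A_sym copA neq_ij ler01.
  rewrite !A_diag; have := A_entries i i j; have := A_entries i j j.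
  (* Positivity of [2 + 3 (a_iij + a_ijj)] excludes the sums -1 and -2. *)
  by rewrite !inE; case/or3P=> /eqP-> /or3P[] /eqP->; lra.
case: A_rst => r [s [t [[rs st rt] [Arss Artt A012]]]] x x_neq0 x_ge0.
have Urst : uniq [:: r; s; t] by rewrite /= !inE negb_or rs rt st.
have Arst : A r s t = 1.
  (* Both index triples enumerate ['I_3], hence are permutations of each other. *)
  rewrite -A012; apply: A_sym.
  by rewrite -(permPl (perm_index_enum3 Urst)) perm_index_enum3.
have entry_ge i j k : -1 <= A i j k.
  by have := A_entries i j k; rewrite !inE => /or3P[] /eqP->; lra.
rewrite (cubic_formE x A_sym Urst) !A_diag Arss Artt Arst !mul1r mulr1.
by apply: ternary_cubic_gt0 => //; [exact: A_pair | exact: cv3_gt0_sum].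
Qed.
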